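(* Let $f:(0,\infty)\to[0,1]$ be a function that decreases to zero (i.e. $f$ is decreasing and $\lim_{t\to\infty}f(t)=0$), let $(G_t)_{t\ge 0}=(G_t(f))_{t\ge0}$ be the random multigraph process with parameter $f$, and let $\omega_t$ be the clique number of $G_t$. Then for every $\delta\in(0,1)$ there exists a constant $c_2>0$, depending on $\delta$ and $f$ only, such that for all integers $t\ge 2$ $$ \mathbb{P}\left(\omega_t\ge \frac{c_2\,\mathbb{E}\left[|G_{t^{(1-\delta)/2}}|\right]}{\log t}\right)\ \ge\ 1-\frac{2}{\log t}-\exp\left\{-\frac{c_2\,\mathbb{E}\left[|G_{t^{(1-\delta)/2}\log t}|\right]}{4\log t}\right\}. $$
   Context: Multigraphs may have loops and multiple edges; a loop contributes 2 to the degree of its vertex. For a finite connected multigraph $G$, $\pi_G$ is the probability distribution on its vertices $\pi_G(v)=\deg(v)/\sum_{w\in G}\deg(w)$. Process $G_t(f)$: let $(Z_t)_{t\ge1}$ be independent with $Z_t\sim\mathrm{Ber}(f(t))$. $G_0$ is one vertex with one self-loop. Given $G_t$ and independently of the past: if $Z_{t+1}=1$ (vertex-step), add a new vertex and connect it by one edge to a vertex of $G_t$ chosen according to $\pi_{G_t}$; if $Z_{t+1}=0$ (edge-step), add a new edge between two vertices of $G_t$ chosen independently, each according to $\pi_{G_t}$ (possibly creating a loop or a multiple edge). The result is $G_{t+1}$. $|G|$ denotes the number of vertices of $G$; for real $r\ge0$, $G_r$ means $G_{\lfloor r\rfloor}$. The clique number of a multigraph is the largest size of a set of vertices that are pairwise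 adjacent. *)

(* Defs.v *)
From HB Require Import structures.
From mathcomp Require Import all_boot all_order all_algebra.
From mathcomp Require Import all_classical all_reals all_analysis.

Set Implicit Arguments.
Unset Strict Implicit.
Unset Printing Implicit Defensive.

Import Order.TTheory GRing.Theory Num.Theory.
Import numFieldNormedType.Exports.

Local Open Scope classical_set_scope.
Local Open Scope ring_scope.

(* A finite multigraph: a number n of vertices (numbered 0, ..., n-1 in order
   of birth) and the list of its edges.  Repetitions in the list are multiple
   edges and a pair (v, v) is a loop; the order of the two endpoints of an edge
   carries no meaning (see [degree] and [adjacent]). *)
Definition mgraph := {n : nat & seq ('I_n * 'I_n)}.

Definition nb_vertices (g : mgraph) : nat := tag g.
Definition edges (g : mgraph) : seq ('I_(nb_vertices g) * 'I_(nb_vertices g)) := tagged g.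

Definition mk_mgraph (n : nat) (E : seq ('I_n * 'I_n)) : mgraph :=
  Tagged (fun n => seq ('I_n * 'I_n)) E.

Definition degree (g : mgraph) (v : 'I_(nb_vertices g)) : nat :=
  \sum_(e <- edges g) ((e.1 == v) + (e.2 == v)).

Definition adjacent (g : mgraph) (u v : 'I_(nb_vertices g)) : bool :=
  ((u, v) \in edges g) || ((v, u) \in edges g).

Definition is_clique (g : mgraph) (A : {set 'I_(nb_vertices g)}) : bool :=
  [forall u in A, forall v in A, (u != v) ==> adjacent u v].

Definition clique_number (g : mgraph) : nat :=
  \max_(A : {set 'I_(nb_vertices g)} | is_clique A) #|A|.

Definition single_loop : mgraph := mk_mgraph [:: (ord0 : 'I_1, ord0)].

(* [widen_ord (leqnSn n)] keeps the number of an old vertex; the new vertex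
   is [ord_max]. *)
Definition add_vertex (g : mgraph) (v : 'I_(nb_vertices g)) : mgraph :=
  let w := widen_ord (leqnSn (nb_vertices g)) in
  mk_mgraph ((w v, ord_max) :: [seq (w e.1, w e.2) | e <- edges g]).

Definition add_edge (g : mgraph) (u v : 'I_(nb_vertices g)) : mgraph :=
  mk_mgraph ((u, v) :: edges g).

Section process.
Context {R : realType}.

Definition pi_deg (g : mgraph) (v : 'I_(nb_vertices g)) : R :=
  (degree v)%:R / (\sum_(w < nb_vertices g) degree w)%N%:R.

(* The conditional probability that G_{t+1} = h given G_t = g and
   Z_{t+1} = z. *)
Definition step_prob (z : bool) (g h : mgraph) : R :=
  if z then \sum_(v : 'I_(nb_vertices g) | add_vertex v == h) pi_deg v
  else \sum_(u : 'I_(nb_vertices g)) \sum_(v : 'I_(nb_vertices g) | add_edge u v == h)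
         pi_deg u * pi_deg v.

Context d (T : measurableType d).

(* The event that (Z_1, ..., Z_t) and (G_0, ..., G_t) follow the
   trajectories z and g. *)
Definition history (Z : nat -> T -> bool) (G : nat -> T -> mgraph) (t : nat)
    (z : nat -> bool) (g : nat -> mgraph) : set T :=
  [set x | (forall s, (1 <= s <= t)%N -> Z s x = z s) /\
           (forall s, (s <= t)%N -> G s x = g s)].

(* (G_t) is the process with parameter f, driven by (Z_t)_{t >= 1} (Z 0 plays
   no role).  [process_Z] says that Z_{t+1} ~ Ber(f(t+1)) is independent of
   the past (in particular the Z_t are independent), [process_step] that, given
   the whole past and Z_{t+1}, the law of G_{t+1} is [step_prob].  Conditioning
   is on the atoms of the past, which is countably valued. *)
Record is_process (f : R -> R) (P : probability T R)
    (Z : nat -> T -> bool) (G : nat -> T -> mgraph) : Prop := IsProcess {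
  process_measurable_Z : forall t z, measurable [set x | Z t x = z];
  process_measurable_G : forall t g, measurable [set x | G t x = g];
  process_init : forall x, G 0%N x = single_loop;
  process_Z : forall t z g b,
    P (history Z G t z g `&` [set x | Z t.+1 x = b]) =
    (P (history Z G t z g) * (bernoulli_pmf (f t.+1%:R) b)%:E)%E;
  process_step : forall t z g b h,
    P (history Z G t z g `&` [set x | Z t.+1 x = b]
                         `&` [set x | G t.+1 x = h]) =
    (P (history Z G t z g `&` [set x | Z t.+1 x = b]) *
       (step_prob b (g t) h)%:E)%E
}.

(* E |G_{floor r}| for r >= 0; for a process as above it is finite, since
   |G_s| <= s + 1 almost surely. *)
Definition mean_nb_vertices (P : probability T R) (G : nat -> T -> mgraph) (r : R) : R :=
  fine ('E_P[fun x => (nb_vertices (G (Num.truncn r) x))%:R])%E.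

End process.

(* Main.v *)
(* Put r = t^((1-delta)/2) and F = E |G_r|.  By Chebyshev's inequality G_r has at
   least k ~ F/2 vertices, up to probability 4/F.  Since f tends to 0, after time
   r a degree grows like a power close to 1 of time: the mean of an order -1/2
   moment of the degree of a given vertex contracts by (r/t)^(1/2 - delta/8)
   between r and t/2, so that all but few of the first k vertices are hubs, of
   degree at least t^(1/2 + delta/8), at time t/2.  Between t/2 and t two hubs
   fail to be joined with probability at most exp(- t^(delta/4) / 16), so the hubs
   form a clique.  Each of the three errors is at most 1/(2 log t) as soon as t is
   large and c2 F / log t > 1.  If c2 F / log t <= 1, which a small c2 ensures for
   the finitely many other t, a one-vertex clique suffices. *)
Require Import Defs.
From HB Require Import structures.
From mathcomp Require Import all_boot all_order all_algebra.
From mathcomp Require Import all_classical all_reals all_analysis.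
From mathcomp Require Import measurable_realfun.
From mathcomp Require Import ring lra zify.

Set Implicit Arguments.
Unset Strict Implicit.
Unset Printing Implicit Defensive.

Import Order.TTheory GRing.Theory Num.Theory.
Import numFieldNormedType.Exports.

Local Open Scope classical_set_scope.
Local Open Scope ring_scope.

(** * Conditional means along the process *)

(** Invariants that survive every possible step, whatever its probability. The one-step bounds hold
    only for suitable graphs; an invariant carries this suitability through iterated means without
    any null sets. *)
Definition stable (I : nat -> mgraph -> Prop) : Prop :=
  forall u g, I u g ->
    (forall v, I u.+1 (@add_vertex g v)) /\ (forall v w, I u.+1 (@add_edge g v w)).

(** The graph at time [u] has u + 1 edges, hence total degree 2 (u + 1): the denominator in [pi_deg]
    is deterministic. *)
Definition size_at (u : nat) (g : mgraph) : Prop := size (edges g) = u.+1.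

Lemma size_at_stable : stable size_at.
Proof.
by move=> u g; rewrite /size_at => gu; split=> [v|v w] /=; rewrite ?size_map gu.
Qed.

Lemma size_at_single_loop : size_at 0 single_loop.
Proof. by []. Qed.

Lemma stableI (I J : nat -> mgraph -> Prop) :
  stable I -> stable J -> stable (fun u g => I u g /\ J u g).
Proof.
by move=> sI sJ u g [/sI[I1 I2] /sJ[J1 J2]]; split.
Qed.

Lemma sum_degree (g : mgraph) :
  (\sum_(w < nb_vertices g) degree w = (size (edges g)).*2)%N.
Proof.
rewrite /degree exchange_big /= -muln2 mulnC -sum1_size big_distrr /=.
apply: eq_bigr => e _; rewrite big_split /= muln1.
have sum_eq (a : 'I_(nb_vertices g)) : (\sum_i (a == i) = 1)%N.
  rewrite (bigD1 a) //= eqxx big1 ?addn0 // => i ia.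
  by rewrite eq_sym (negbTE ia).
by rewrite !sum_eq.
Qed.

Section step_mean.
Context {R : realType}.
Implicit Types (p : R) (phi psi : mgraph -> R) (g : mgraph).

Lemma pi_deg_ge0 g (v : 'I_(nb_vertices g)) : 0 <= pi_deg v :> R.
Proof. by rewrite /pi_deg divr_ge0. Qed.

Lemma sum_pi_deg g : edges g != [::] -> \sum_v @pi_deg R g v = 1.
Proof.
move=> g0; rewrite /pi_deg -mulr_suml -natr_sum divff //.
by rewrite sum_degree pnatr_eq0 double_eq0 size_eq0.
Qed.

(* The conditional mean of phi (G_{t+1}) given G_t = g, with p = f (t + 1). *)
Definition step_mean p phi g : R :=
  p * (\sum_v pi_deg v * phi (@add_vertex g v)) +
  (1 - p) * (\sum_u \sum_v pi_deg u * pi_deg v * phi (@add_edge g u v)).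

Lemma le_step_mean p phi psi g : 0 <= p <= 1 ->
  (forall v, phi (@add_vertex g v) <= psi (@add_vertex g v)) ->
  (forall u v, phi (@add_edge g u v) <= psi (@add_edge g u v)) ->
  step_mean p phi g <= step_mean p psi g.
Proof.
move=> /andP[p0 p1] pv pe; apply: lerD; apply: ler_wpM2l; rewrite ?subr_ge0 //.
  by apply: ler_sum => v _; apply: ler_wpM2l; rewrite ?pi_deg_ge0.
apply: ler_sum => u _; apply: ler_sum => v _.
by apply: ler_wpM2l; rewrite ?mulr_ge0 ?pi_deg_ge0.
Qed.

Lemma step_mean_cst p (c : R) g : edges g != [::] ->
  step_mean p (fun=> c) g = c.
Proof.
move=> g0; rewrite /step_mean -mulr_suml sum_pi_deg //.
under eq_bigr do rewrite -mulr_suml -mulr_sumr sum_pi_deg //.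
by rewrite -mulr_suml; under eq_bigr do rewrite mulr1; rewrite sum_pi_deg //; ring.
Qed.

Lemma step_mean_linear p (a b : R) phi psi g :
  step_mean p (fun h => a * phi h + b * psi h) g =
  a * step_mean p phi g + b * step_mean p psi g.
Proof.
rewrite /step_mean.
under eq_bigr do rewrite mulrDr !(mulrCA (pi_deg _)).
rewrite big_split /= -!mulr_sumr.
under [X in _ + (1 - p) * X = _]eq_bigr => u _.
  under eq_bigr do rewrite mulrDr !(mulrCA (pi_deg _ * pi_deg _)).
  rewrite big_split /= -!mulr_sumr; over.
by rewrite big_split /= -!mulr_sumr; ring.
Qed.

Section run_mean.
Variable f : R -> R.

(* The conditional mean of phi (G_{s+n}) given G_s = g. *)
Fixpoint run_mean (n s : nat) phi : mgraph -> R :=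
  if n is n'.+1 then step_mean (f s.+1%:R) (run_mean n' s.+1 phi) else phi.

Lemma run_mean_add n m s phi :
  run_mean (n + m) s phi = run_mean n s (run_mean m (s + n) phi).
Proof. by elim: n s => [|n IHn] s /=; rewrite ?addn0 // IHn addSnnS. Qed.

Lemma run_mean_linear n s (a b : R) phi psi g :
  run_mean n s (fun h => a * phi h + b * psi h) g =
  a * run_mean n s phi g + b * run_mean n s psi g.
Proof.
elim: n s g => [//|n IHn] s g /=; rewrite -step_mean_linear.
by congr step_mean; apply/funext => h; rewrite IHn.
Qed.

Lemma run_meanD n s phi psi g :
  run_mean n s (fun h => phi h + psi h) g = run_mean n s phi g + run_mean n s psi g.
Proof.
have := run_mean_linear n s 1 1 phi psi g; rewrite !mul1r => <-.
by congr run_mean; apply/funext => h; rewrite !mul1r.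
Qed.

Lemma run_meanZ n s a phi g :
  run_mean n s (fun h => a * phi h) g = a * run_mean n s phi g.
Proof.
have := run_mean_linear n s a 0 phi phi g; rewrite mul0r addr0 => <-.
by congr run_mean; apply/funext => h; rewrite mul0r addr0.
Qed.

Lemma run_mean_sum n s (J : Type) (r : seq J) (Q : pred J) (phi : J -> mgraph -> R) g :
  run_mean n s (fun h => \sum_(j <- r | Q j) phi j h) g =
  \sum_(j <- r | Q j) run_mean n s (phi j) g.
Proof.
elim: r => [|j r IHr].
  rewrite big_nil -[RHS](mul0r (run_mean n s (fun=> 0) g)) -run_meanZ.
  by congr run_mean; apply/funext => h; rewrite big_nil mul0r.
rewrite big_cons -IHr; case: ifPn => Qj; [rewrite -run_meanD|];
  by congr run_mean; apply/funext => h; rewrite big_cons ?Qj ?(negbTE Qj).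
Qed.

Hypothesis f01 : forall x : R, 0 < x -> 0 <= f x <= 1.

(** Iterates the one-step inequality by monotonicity of [step_mean]. The moment bounds below come
    from an [h] that equals the target at the final time and carries, before it, the correction for
    the steps still to come. *)
Lemma run_mean_supermartingale (I : nat -> mgraph -> Prop)
    (h : nat -> mgraph -> R) n s g : stable I ->
  (forall u g, (s <= u < s + n)%N -> I u g ->
     step_mean (f u.+1%:R) (h u.+1) g <= h u g) ->
  I s g -> run_mean n s (h (s + n)%N) g <= h s g.
Proof.
move=> sI; elim: n s g => [|n IHn] s g hh Ig /=; first by rewrite addn0.
apply: le_trans (hh s g _ Ig); last by rewrite leqnn addnS ltnS leq_addr.
have {}IHn k : I s.+1 k -> run_mean n s.+1 (h (s + n.+1)%N) k <= h s.+1 k.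
  move=> Ik; rewrite -addSnnS; apply: IHn => // u k' /andP[su us].
  by apply: hh; rewrite (ltnW su) -addSnnS.
have [Iv Ie] := sI s g Ig.
by apply: le_step_mean => [|v|u v]; rewrite ?f01 ?IHn.
Qed.

Lemma le_run_mean (I : nat -> mgraph -> Prop) phi psi n s g : stable I ->
  (forall h, I (s + n)%N h -> phi h <= psi h) -> I s g ->
  run_mean n s phi g <= run_mean n s psi g.
Proof.
move=> sI; elim: n s g => [|n IHn] s g pp Ig /=; first by apply: pp; rewrite addn0.
have [Iv Ie] := sI s g Ig.
by apply: le_step_mean => [|v|u v]; rewrite ?f01 //; apply: IHn => //; rewrite addSnnS.
Qed.

(** The weights of a step sum to 1 once there is an edge, which [size_at] provides. *)
Lemma run_mean_cst n s c g : size_at s g -> run_mean n s (fun=> c) g = c.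
Proof.
move=> sg; elim: n s g sg => [//|n IHn] s g sg /=.
have [Iv Ie] := size_at_stable sg.
have g0 : edges g != [::] by rewrite -size_eq0 sg.
by apply/eqP; rewrite eq_le -[X in (_ <= X) && _](step_mean_cst (f s.+1%:R) c g0)
   -[X in _ && (X <= _)](step_mean_cst (f s.+1%:R) c g0);
   apply/andP; split; apply: le_step_mean => [|v|u v]; rewrite ?f01 ?IHn.
Qed.

End run_mean.
End step_mean.

(** * From conditional means to probabilities *)

Section transfer.
Context {R : realType} d (T : measurableType d) (P : probability T R).

Lemma measurable_preimage_count (I : countType) (Y : T -> I) (A : set I) :
  (forall i, measurable [set x | Y x = i]) -> measurable [set x | A (Y x)].
Proof.
move=> mY; have -> : [set x | A (Y x)] =
    \bigcup_i (if pselect (A i) then [set x | Y x = i] else set0).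
  apply/seteqP; split => x /=.
    by move=> Ax; exists (Y x) => //; case: pselect.
  by case=> i _; case: pselect => //= Ai ->.
apply: countable_bigcupT_measurable; first exact: countableP.
by move=> i; case: pselect => ?; [exact: mY|exact: measurable0].
Qed.

(** A finite list of values is enough: from a given history, one step has finitely many possible
    outcomes, so no countable sum arises. *)
Lemma sum_prob_fibers_le (I : eqType) (Y : T -> I) (r : seq I) (A : set T) :
  (forall i, measurable [set x | Y x = i]) -> measurable A -> uniq r ->
  \sum_(i <- r) fine (P (A `&` [set x | Y x = i])) <= fine (P A).
Proof.
move=> mY; elim: r A => [|i r IHr] A mA; first by rewrite big_nil fine_ge0.
rewrite big_cons /= => /andP[ir ur].
have mAi : measurable (A `\` [set x | Y x = i]) by apply: measurableD.
rewrite (measureDI P mA (mY i)) fineD ?fin_num_measure //; last exact: measurableI.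
rewrite addrC lerD2r; apply: le_trans (IHr _ mAi ur).
rewrite !big_seq; apply: ler_sum => j jr.
suff -> : (A `\` [set x | Y x = i]) `&` [set x | Y x = j] = A `&` [set x | Y x = j] by [].
apply/seteqP; split => x /=; first by case=> -[].
by case=> Ax Yj; split=> //; split=> // Yi; move: ir; rewrite -Yi Yj jr.
Qed.

Context (f : R -> R) (Z : nat -> T -> bool) (G : nat -> T -> mgraph).
Hypothesis process : is_process f P Z G.
Hypothesis f01 : forall x : R, 0 < x -> 0 <= f x <= 1.

Let pr A := fine (P A).

Lemma measurable_history s z g : measurable (history Z G s z g).
Proof.
elim: s => [|s IHs].
  rewrite (_ : history _ _ _ _ _ = [set x | G 0%N x = g 0%N]).
    exact: (process_measurable_G process).
  apply/seteqP; split => x /=; first by case=> _; apply.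
  by move=> Gx; split=> [[|s]|[|s]].
rewrite (_ : history _ _ _ _ _ = history Z G s z g `&`
  [set x | Z s.+1 x = z s.+1] `&` [set x | G s.+1 x = g s.+1]).
  apply: measurableI (process_measurable_G process _ _).
  exact: measurableI (process_measurable_Z process _ _).
apply/seteqP; split => x /=.
  by case=> zx gx; split; [split; [split=> u us|]|]; rewrite ?zx ?gx //; lia.
case=> -[[zx gx] zs] gs; split=> u us.
  by case: (u =P s.+1) => [->//|us']; apply: zx; lia.
by case: (u =P s.+1) => [->//|us']; apply: gx; lia.
Qed.

Definition update (X : Type) (z : nat -> X) (s : nat) (b : X) : nat -> X :=
  fun u => if u == s then b else z u.

Lemma historyS s z g b h :
  history Z G s z g `&` [set x | (Z s.+1 x, G s.+1 x) = (b, h)] =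
  history Z G s.+1 (update z s.+1 b) (update g s.+1 h).
Proof.
apply/seteqP; split => x /=.
  case=> -[zx gx] [zs gs]; split=> u us; rewrite /update;
    by case: eqP => [->//|us']; rewrite ?zx ?gx //; lia.
rewrite /update; case=> zx gx; split; first split=> u us.
- by rewrite zx; [case: eqP => // us'; exfalso; lia|lia].
- by rewrite gx; [case: eqP => // us'; exfalso; lia|lia].
- by rewrite zx ?gx ?eqxx /= ?leqnn.
Qed.

Lemma prob_historyS s z g b h :
  pr (history Z G s.+1 (update z s.+1 b) (update g s.+1 h)) =
  pr (history Z G s z g) * (bernoulli_pmf (f s.+1%:R) b * step_prob b (g s) h).
Proof.
rewrite -historyS /pr; set H := history _ _ _ _ _.
have -> : H `&` [set x | (Z s.+1 x, G s.+1 x) = (b, h)] =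
    H `&` [set x | Z s.+1 x = b] `&` [set x | G s.+1 x = h].
  apply/seteqP; split => x /=; first by case=> ? [].
  by case=> -[? -> ->].
rewrite (process_step process) (process_Z process).
have fH : P H \is a fin_num by apply: fin_num_measure; exact: measurable_history.
by rewrite !fineM ?fin_numM //= mulrA.
Qed.

(** Groups the choices [j] by the graph they produce, so that [step_prob] appears without any
    injectivity of [F]. *)
Lemma sum_undup_fibers (I : eqType) (J : finType) (F : J -> I) (w : J -> R)
    (psi : I -> R) :
  \sum_(h <- undup [seq F j | j : J]) (\sum_(j | F j == h) w j) * psi h =
  \sum_j w j * psi (F j).
Proof.
under eq_bigr do rewrite big_distrl /=.
rewrite (exchange_big_dep predT) //=; apply: eq_bigr => j _.
rewrite -big_filter (eq_filter (a2 := pred1 (F j))); last by move=> h; rewrite /= eq_sym.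
rewrite filter_pred1_uniq ?big_seq1 ?undup_uniq //.
by rewrite mem_undup map_f ?mem_enum.
Qed.

(** Only a lower bound, by induction on [n] over the possible first steps. Applied to an event and
    to its complement, it will yield an equality. *)
Lemma run_mean_le_prob (A : set mgraph) n s z g :
  pr (history Z G s z g) * run_mean f n s (fun h => (`[< A h >])%:R) (g s) <=
  pr (history Z G s z g `&` [set x | A (G (s + n)%N x)]).
Proof.
have mA u : measurable [set x | A (G u x)].
  by apply: measurable_preimage_count => k; exact: process_measurable_G process u k.
elim: n s z g => [|n IHn] s z g.
  rewrite /= addn0 /pr; case: asboolP => gA; last by rewrite mulr0 fine_ge0.
  rewrite mulr1 (_ : _ `&` _ = history Z G s z g) //.
  by apply/seteqP; split => x /= => [[]//|[zx gx]]; rewrite gx.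
rewrite /=; set psi := run_mean f n s.+1 _.
pose r1 := undup [seq @add_vertex (g s) v | v : 'I_(nb_vertices (g s))].
pose r2 := undup [seq @add_edge (g s) e.1 e.2 |
  e : ('I_(nb_vertices (g s)) * 'I_(nb_vertices (g s)))%type].
(* All pairs (value of [Z], next graph) that the step can produce; the boolean keeps the two lists
   disjoint. *)
pose r := [seq (true, h) | h <- r1] ++ [seq (false, h) | h <- r2].
have r_uniq : uniq r.
  rewrite cat_uniq !map_inj_uniq ?undup_uniq; try by move=> ? ? [].
  rewrite andbT /=; apply/hasPn => -[b h] /mapP[k _ [-> ->]].
  by apply/mapP => -[].
have stepE b : \sum_(h <- (if b then r1 else r2)) step_prob b (g s) h * psi h =
    if b then \sum_v pi_deg v * psi (@add_vertex (g s) v)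
    else \sum_u \sum_v pi_deg u * pi_deg v * psi (@add_edge (g s) u v).
  case: b; first exact: sum_undup_fibers.
  rewrite pair_bigA /= -sum_undup_fibers; apply: eq_bigr => h _ /=.
  by rewrite pair_big_dep.
pose Y x := (Z s.+1 x, G s.+1 x).
have mY i : measurable [set x | Y x = i].
  case: i => b h; rewrite (_ : [set x | _] =
    [set x | Z s.+1 x = b] `&` [set x | G s.+1 x = h]).
    apply: measurableI; first exact: process_measurable_Z process _ _.
    exact: process_measurable_G process _ _.
  by apply/seteqP; split => x /= => [[-> ->]|[<- <-]].
apply: le_trans (sum_prob_fibers_le mY _ r_uniq); last first.
  by apply: measurableI => //; exact: measurable_history.
pose w (i : bool * mgraph) := pr (history Z G s z g) *
  (bernoulli_pmf (f s.+1%:R) i.1 * (step_prob i.1 (g s) i.2 * psi i.2)).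
have -> : pr (history Z G s z g) * step_mean (f s.+1%:R) psi (g s) = \sum_(i <- r) w i.
  rewrite /w -mulr_sumr big_cat !big_map /= -!mulr_sumr.
  by rewrite (stepE true) (stepE false).
apply: ler_sum => -[b h] _; rewrite /w /= setIAC historyS.
have := IHn s.+1 (update z s.+1 b) (update g s.+1 h).
have updE : update g s.+1 h s.+1 = h by rewrite /update eqxx.
by rewrite updE prob_historyS -!mulrA addSnnS.
Qed.

Lemma run_mean_single_loop_le_prob (A : set mgraph) t :
  run_mean f t 0 (fun h => (`[< A h >])%:R) single_loop <= pr [set x | A (G t x)].
Proof.
have := run_mean_le_prob A t 0 (fun=> true) (fun=> single_loop).
rewrite (_ : history _ _ _ _ _ = setT); first by rewrite setTI /pr probability_setT mul1r.
apply/seteqP; split => x //= _; split=> u; first by case: u.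
by rewrite leqn0 => /eqP ->; exact: process_init process x.
Qed.

Lemma measurable_process_event (A : set mgraph) t : measurable [set x | A (G t x)].
Proof.
by apply: measurable_preimage_count => k; exact: process_measurable_G process t k.
Qed.

(** The lower bounds for [A] and for its complement add up to 1 by [run_mean_cst], which leaves no
    slack in either. *)
Lemma prob_process (A : set mgraph) t :
  P [set x | A (G t x)] = (run_mean f t 0 (fun h => (`[< A h >])%:R) single_loop)%:E.
Proof.
have mA := measurable_process_event A t.
have fA : P [set x | A (G t x)] \is a fin_num by exact: fin_num_measure.
rewrite -(fineK fA); congr EFin; apply/eqP; rewrite eq_le.
rewrite run_mean_single_loop_le_prob andbT.
have := run_mean_single_loop_le_prob (~` A) t.
rewrite /pr (_ : [set x | _] = ~` [set x | A (G t x)]) // probability_setC //.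
rewrite fineB ?fin_num_measure //=.
rewrite (_ : run_mean _ _ _ _ _ =
  1 - run_mean f t 0 (fun h => (`[< A h >])%:R) single_loop); first lra.
rewrite -[X in _ = X - _](run_mean_cst f01 t 1 size_at_single_loop).
rewrite -[X in _ = _ + X]mulN1r -run_meanZ -run_meanD.
congr (run_mean _ _ _ _ _); apply/funext => h.
have -> : `[< (~` A) h >] = ~~ `[< A h >] by exact: asbool_neg.
by case: `[< A h >] => /=; ring.
Qed.

End transfer.

(** * The number of vertices *)

Section vertex_count.
Context {R : realType} (f : R -> R).
Hypothesis f01 : forall x : R, 0 < x -> 0 <= f x <= 1.

(** The mean of |G_t|: the initial vertex plus the expected number of vertex-steps. *)
Definition vertex_mean (t : nat) : R := 1 + \sum_(i < t) f i.+1%:R.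

Lemma vertex_meanS t : vertex_mean t.+1 = vertex_mean t + f t.+1%:R.
Proof. by rewrite /vertex_mean big_ord_recr /= addrA. Qed.

Lemma vertex_mean_le t : vertex_mean t <= t.+1%:R.
Proof.
elim: t => [|t IHt]; first by rewrite /vertex_mean big_ord0 addr0.
by rewrite vertex_meanS -[leRHS]natr1 lerD //; case/andP: (f01 (ltr0Sn R t)).
Qed.

Lemma step_mean_nb_vertices (p : R) (phi : nat -> R) g : edges g != [::] ->
  step_mean p (fun h => phi (nb_vertices h)) g =
  p * phi (nb_vertices g).+1 + (1 - p) * phi (nb_vertices g).
Proof.
move=> g0; rewrite /step_mean; congr (p * _ + (1 - p) * _).
  transitivity ((\sum_v @pi_deg R g v) * phi (nb_vertices g).+1).
    by rewrite mulr_suml.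
  by rewrite sum_pi_deg // mul1r.
transitivity (\sum_u \sum_v @pi_deg R g u * @pi_deg R g v * phi (nb_vertices g)); first by [].
under eq_bigr do rewrite -mulr_suml -mulr_sumr sum_pi_deg // mulr1.
by rewrite -mulr_suml sum_pi_deg // mul1r.
Qed.

Lemma size_at_neq0 u g : size_at u g -> edges g != [::].
Proof. by rewrite /size_at => gu; rewrite -size_eq0 gu. Qed.

Lemma run_mean_nb_vertices_le t :
  run_mean f t 0 (fun h => (nb_vertices h)%:R) single_loop <= vertex_mean t.
Proof.
pose h u (g : mgraph) : R := (nb_vertices g)%:R + (vertex_mean t - vertex_mean u).
have hE : h t = fun g => (nb_vertices g)%:R.
  by apply/funext => g; rewrite /h subrr addr0.
have -> : vertex_mean t = h 0%N single_loop.
  by rewrite /h /vertex_mean big_ord0 /=; ring.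
rewrite -hE; apply: (run_mean_supermartingale f01 size_at_stable) => // u g _ ug.
rewrite (step_mean_nb_vertices _ (fun n => n%:R + _)) ?(size_at_neq0 ug) //.
by rewrite /h vertex_meanS -natr1 le_eqVlt; apply/orP; left; apply/eqP; ring.
Qed.

(** In one step the squared deviation grows in mean by f (1 - f) <= f, the increment of
    [vertex_mean]; the compensated square is therefore a supermartingale. *)
Lemma run_mean_variance_le t :
  run_mean f t 0 (fun h => ((nb_vertices h)%:R - vertex_mean t) ^+ 2) single_loop
    <= vertex_mean t.
Proof.
pose h u (g : mgraph) : R :=
  ((nb_vertices g)%:R - vertex_mean u) ^+ 2 + (vertex_mean t - vertex_mean u).
have hE : h t = fun g => ((nb_vertices g)%:R - vertex_mean t) ^+ 2.
  by apply/funext => g; rewrite /h subrr addr0.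
apply: (@le_trans _ _ (h 0%N single_loop)); last first.
  by rewrite /h /vertex_mean big_ord0 /=; lra.
rewrite -hE; apply: (run_mean_supermartingale f01 size_at_stable) => // u g _ ug.
rewrite (step_mean_nb_vertices _ (fun n => (n%:R - _) ^+ 2 + _)) ?(size_at_neq0 ug) //.
rewrite /h vertex_meanS -natr1.
by have := sqr_ge0 (f u.+1%:R); nra.
Qed.

(** Chebyshev's inequality: fewer than [k] vertices means a deviation of at least half the mean. *)
Lemma run_mean_few_vertices t k : 0 < vertex_mean t -> k%:R <= vertex_mean t / 2 ->
  run_mean f t 0 (fun h => (nb_vertices h < k)%N%:R) single_loop <= 4 / vertex_mean t.
Proof.
move=> F0 kF; have F_neq0 := lt0r_neq0 F0.
have -> : 4 / vertex_mean t = 4 / vertex_mean t ^+ 2 * vertex_mean t by field.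
apply: le_trans (_ : _ <= 4 / vertex_mean t ^+ 2 *
  run_mean f t 0 (fun h => ((nb_vertices h)%:R - vertex_mean t) ^+ 2) single_loop) _.
  rewrite -run_meanZ; apply: (le_run_mean f01 size_at_stable) => // h _.
  case: ltnP => hk /=; last by rewrite mulr_ge0 ?sqr_ge0 // divr_ge0 // sqr_ge0.
  rewrite mulrAC ler_pdivlMr ?exprn_gt0 // mul1r.
  have : (nb_vertices h)%:R <= k%:R :> R by rewrite ler_nat ltnW.
  by nra.
apply: ler_wpM2l; first by rewrite divr_ge0 // sqr_ge0.
exact: run_mean_variance_le.
Qed.

Lemma sum_ltn (m n : nat) : (\sum_(j < m) (j < n : nat) = minn m n)%N.
Proof.
elim: m => [|m IHm]; first by rewrite big_ord0 min0n.
by rewrite big_ord_recr /= IHm; case: (ltnP m n) => mn /=; lia.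
Qed.

Definition few_vertices (u : nat) (g : mgraph) : Prop := (nb_vertices g <= u.+1)%N.

Lemma few_vertices_stable : stable few_vertices.
Proof.
by move=> u g; rewrite /few_vertices => gu; split=> [v|v w] /=; lia.
Qed.

(** One inequality suffices later, since the clique threshold increases with the mean. The
    expectation is reduced to the probabilities of the events j < |G_s|, to which [prob_process]
    applies. *)
Lemma mean_nb_vertices_le d (T : measurableType d) (P : probability T R)
    (Z : nat -> T -> bool) (G : nat -> T -> mgraph) (r : R) :
  is_process f P Z G -> mean_nb_vertices P G r <= vertex_mean (Num.truncn r).
Proof.
move=> process; rewrite /mean_nb_vertices unlock; set s := Num.truncn r.
have measurable_phi (phi : mgraph -> \bar R) : measurable_fun setT (fun x => phi (G s x)).
  move=> _ Y mY; rewrite setTI.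
  exact: (measurable_process_event process (fun g => Y (phi g)) s).
pose E j := [set x | (j < nb_vertices (G s x))%N].
have mE j : measurable (E j).
  exact: (measurable_process_event process (fun g => (j < nb_vertices g)%N) s).
have PE j : P (E j) =
    (run_mean f s 0 (fun h => (`[< (j < nb_vertices h)%N >])%:R) single_loop)%:E.
  exact: (prob_process process f01 (fun g => (j < nb_vertices g)%N)).
(* Since |G_s| <= s + 1 almost surely, |G_s| agrees almost everywhere with the sum over j <= s of
   the indicators of j < |G_s|; the exceptional set lies in [E s.+1]. *)
rewrite (@ge0_ae_eq_integral _ _ _ _ _ _
  (fun x => (\sum_(j < s.+1) (\1_(E j) x)%:E)%E)) //=; last 4 first.
- exact: (measurable_phi (fun g => (nb_vertices g)%:R%:E)).
- by apply: emeasurable_sum => j; apply/measurable_EFinP; exact: measurable_indic.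
- by move=> x _; apply: sume_ge0 => j _; rewrite lee_fin indicE.
- exists (E s.+1); split => //.
    apply: etrans (PE _) _; congr EFin; apply/eqP; rewrite eq_le; apply/andP; split.
      rewrite -[leRHS](run_mean_cst f01 s 0 size_at_single_loop).
      apply: (le_run_mean f01 few_vertices_stable) => // h; rewrite /few_vertices add0n => hs.
      by case: asboolP => //; lia.
    rewrite -[leLHS](run_mean_cst f01 s 0 size_at_single_loop).
    by apply: (le_run_mean f01 few_vertices_stable).
  move=> x /=; rewrite /E /= => neq; rewrite ltnNge; apply/negP => xs; apply: neq => _.
  rewrite sumEFin; congr EFin.
  rewrite -[X in X%:R](minn_idPr xs) -sum_ltn natr_sum; apply: eq_bigr => j _.
  rewrite indicE; congr (nat_of_bool _)%:R.
  by apply/idP/idP => [jx|/set_mem//]; apply/mem_set.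
rewrite ge0_integral_sum //=; last first.
  by move=> j; apply/measurable_EFinP; exact: measurable_indic.
rewrite (eq_bigr (fun j : 'I_s.+1 => (run_mean f s 0
    (fun h => (`[< (j < nb_vertices h)%N >])%:R) single_loop)%:E)); last first.
  by move=> j _; rewrite integral_indic // setIT; exact: PE.
rewrite sumEFin /= -run_mean_sum; apply: le_trans (run_mean_nb_vertices_le _).
apply: (le_run_mean f01 size_at_stable) => // h _.
under eq_bigr do rewrite asboolb.
by rewrite -natr_sum sum_ltn ler_nat geq_minr.
Qed.

End vertex_count.

(** * Growth of the degrees and adjacency of hubs *)

(** Indexing by natural numbers lets a vertex keep its name while the type of vertices changes with
    the graph. *)
Definition degn (g : mgraph) (i : nat) : nat :=
  \sum_(e <- edges g) ((e.1 == i :> nat) + (e.2 == i :> nat)).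

(** Only one orientation of the pair is looked for. This is stronger than adjacency, and for [i = j]
    it asks for a loop. *)
Definition joined (g : mgraph) (i j : nat) : bool :=
  has (fun e => (nat_of_ord e.1 == i) && (nat_of_ord e.2 == j)) (edges g).

Lemma degn_add_vertex (g : mgraph) (v : 'I_(nb_vertices g)) i :
  degn (add_vertex v) i = (degn g i + ((v == i :> nat) + (nb_vertices g == i)))%N.
Proof. by rewrite /degn /= big_cons big_map /= addnC. Qed.

Lemma degn_add_edge (g : mgraph) (u v : 'I_(nb_vertices g)) i :
  degn (add_edge u v) i = (degn g i + ((u == i :> nat) + (v == i :> nat)))%N.
Proof. by rewrite /degn /= big_cons addnC. Qed.

Lemma joined_add_vertex (g : mgraph) (v : 'I_(nb_vertices g)) i j :
  joined g i j -> joined (add_vertex v) i j.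
Proof. by rewrite /joined /= has_map => gij; apply/orP; right. Qed.

Lemma joined_add_edge (g : mgraph) (u v : 'I_(nb_vertices g)) i j :
  joined (add_edge u v) i j =
  [|| (u == i :> nat) && (v == j :> nat) | joined g i j].
Proof. by []. Qed.

Lemma joined_adjacent (g : mgraph) (u v : 'I_(nb_vertices g)) :
  joined g u v -> Defs.adjacent u v.
Proof.
by move=> /hasP[[a b] gab /= /andP[/val_eqP au /val_eqP bv]]; rewrite /Defs.adjacent -au -bv gab.
Qed.

Definition at_least (k : nat) (u : nat) (g : mgraph) : Prop := (k <= nb_vertices g)%N.

Lemma at_least_stable k : stable (at_least k).
Proof. by move=> u g gi; split=> [v|v w] //; exact: leqW gi. Qed.

Definition degree_ge (i m : nat) (u : nat) (g : mgraph) : Prop := (m <= degn g i)%N.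

Lemma degree_ge_stable i m : stable (degree_ge i m).
Proof.
move=> u g; rewrite /degree_ge => mi.
by split=> [v|v w]; rewrite ?degn_add_vertex ?degn_add_edge (leq_trans mi) ?leq_addr.
Qed.

Definition no_isolated (u : nat) (g : mgraph) : Prop :=
  forall i, (i < nb_vertices g)%N -> (0 < degn g i)%N.

Lemma no_isolated_stable : stable no_isolated.
Proof.
move=> u g gpos; split=> [v|v w] i; rewrite ?degn_add_vertex ?degn_add_edge /=.
  by rewrite ltnS leq_eqVlt => /orP[/eqP ->|/gpos]; rewrite ?eqxx; lia.
by move=> /gpos; lia.
Qed.

Section degree_growth.
Context {R : realType}.

Lemma pi_degE u (g : mgraph) (v : 'I_(nb_vertices g)) : size_at u g ->
  pi_deg v = (degn g v)%:R / (2 * u.+1%:R) :> R.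
Proof. by move=> gu; rewrite /pi_deg sum_degree gu -muln2 natrM mulrC [u.+1%:R * _]mulrC mulrC. Qed.

Lemma sum_pi_deg_if (g : mgraph) (i : 'I_(nb_vertices g)) (psi : bool -> R) :
  edges g != [::] ->
  \sum_(v < nb_vertices g) pi_deg v * psi (v == i :> nat) =
  (1 - pi_deg i) * psi false + pi_deg i * psi true.
Proof.
move=> g0; rewrite (bigD1 i) //= eqxx addrC; congr (_ + _).
rewrite -(@sum_pi_deg R g) // [in RHS](bigD1 i) //= addrAC subrr add0r mulr_suml.
by apply: eq_bigr => v /negbTE vi; rewrite val_eqE vi.
Qed.

(** The number of endpoints of a new edge at [i] is binomial with parameters 2 and [pi_deg i]. *)
Lemma sum2_pi_deg_if (g : mgraph) (i : 'I_(nb_vertices g)) (psi : nat -> R) :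
  edges g != [::] ->
  \sum_(u < nb_vertices g) \sum_(v < nb_vertices g) pi_deg u * pi_deg v *
    psi ((u == i :> nat) + (v == i :> nat))%N =
  (1 - pi_deg i) ^+ 2 * psi 0%N + 2 * pi_deg i * (1 - pi_deg i) * psi 1%N +
  pi_deg i ^+ 2 * psi 2%N.
Proof.
move=> g0; under eq_bigr => u _.
  under eq_bigr do rewrite -mulrA.
  rewrite -mulr_sumr (sum_pi_deg_if i (fun b => psi ((u == i :> nat) + b)%N)) //.
  over.
rewrite /= (sum_pi_deg_if i (fun b : bool => (1 - pi_deg i) * psi (b + 0)%N +
  pi_deg i * psi (b + 1)%N)) //=.
by ring.
Qed.

(* decay d is of order d^(-1/2).  Up to time scaling, a degree d jumps to d + 1
   at rate d, and d * (decay d - decay d.+1) = decay d / 2: the mean of the decay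
   of a degree therefore contracts by a factor independent of d, which already
   holds from degree 1 on (1 / sqrt d itself would lose too much there). *)
Definition decay (d : nat) : R := \prod_(1 <= i < d) (1 - (2 * i%:R)^-1).

Lemma decayS d : (0 < d)%N -> decay d.+1 = decay d * (1 - (2 * d%:R)^-1).
Proof. by move=> d0; rewrite /decay big_nat_recr. Qed.

Lemma decay_factor_gt0 d : (0 < d)%N -> 0 < 1 - (2 * d%:R)^-1 :> R.
Proof.
move=> d0; have : 1 <= d%:R :> R by rewrite ler1n.
by move=> d1; rewrite subr_gt0 invf_lt1; lra.
Qed.

Lemma decay_gt0 d : 0 < decay d.
Proof.
rewrite /decay big_nat; apply: prodr_gt0 => i /andP[i0 _].
exact: decay_factor_gt0.
Qed.

Lemma decay_le1 d : decay d <= 1.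
Proof.
rewrite /decay big_nat; apply: prodr_ile1 => i /andP[i0 _].
by rewrite ltW ?decay_factor_gt0 //= gerBl invr_ge0 mulr_ge0.
Qed.

(** The shift by 1 is what closes the induction: with d in place of d - 1 the same step fails. The
    case d = 2 is an equality. *)
Lemma decay_sqr_ge d : (1 < d)%N -> (4 * (d%:R - 1))^-1 <= decay d ^+ 2.
Proof.
elim: d => [//|[//|d] IHd] _; case: d => [|d] in IHd *.
  rewrite decayS // /decay big_geq // mul1r mulr1 (_ : 2%:R - 1 = 1) ?mulr1; last by lra.
  by rewrite le_eqVlt; apply/orP; left; apply/eqP; field.
set D := d.+2 in IHd *; have {}IHd := IHd isT.
have D2 : 2 <= D%:R :> R by rewrite ler_nat.
rewrite decayS // exprMn (_ : D.+1%:R - 1 = D%:R); last by rewrite -[D.+1%:R]natr1 addrK.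
apply: le_trans (ler_wpM2r (sqr_ge0 _) IHd).
rewrite -subr_ge0; set x := D%:R in D2 *.
have -> : (4 * (x - 1))^-1 * (1 - (2 * x)^-1) ^+ 2 - (4 * x)^-1 =
    (16 * x ^+ 2 * (x - 1))^-1 by field; do ?[apply/andP; split]; lra.
by rewrite invr_ge0 !mulr_ge0 ?sqr_ge0 //; lra.
Qed.

Lemma decay_ge d : (0 < d)%N -> (2 * Num.sqrt d%:R)^-1 <= decay d.
Proof.
move=> d0; rewrite -[leRHS]ger0_norm ?(ltW (decay_gt0 d)) // -sqrtr_sqr.
have d1 : 1 <= d%:R :> R by rewrite ler1n.
have -> : (2 * Num.sqrt d%:R)^-1 = Num.sqrt (4 * d%:R)^-1 :> R.
  rewrite sqrtrV ?sqrtrM; last 2 first. by []. by lra.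
  by rewrite (_ : 4 = 2 ^+ 2) ?sqrtr_sqr ?ger0_norm //; lra.
rewrite ler_sqrt ?sqr_ge0 //.
case: (ltnP 1 d) => [d2|]; last first.
  move=> dle1; rewrite (_ : d = 1%N); last lia.
  by rewrite /decay big_geq // expr1n mulr1; lra.
apply: le_trans (decay_sqr_ge d2).
have : 2 <= d%:R :> R by rewrite ler_nat.
by move=> ?; rewrite lef_pV2 ?posrE; lra.
Qed.

(** In an edge-step each endpoint hits [i] with probability d / (2 (u + 1)), and a hit costs [decay]
    the fraction 1 / (2 d): the degree d cancels to first order, and the term in 3 / 16 accounts for
    double hits. The gain of vertex-steps is given up. *)
Lemma step_mean_decay (p : R) u (g : mgraph) (i : nat) : 0 <= p <= 1 ->
  size_at u g -> at_least i.+1 u g -> degree_ge i 1 u g ->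
  step_mean p (fun h => decay (degn h i)) g <=
  decay (degn g i) *
    (1 - (1 - p) * ((2 * u.+1%:R)^-1 - 3 / (16 * u.+1%:R ^+ 2))).
Proof.
move=> p01 gu gi di; have g0 := size_at_neq0 gu.
have [j ji] : {j : 'I_(nb_vertices g) | nat_of_ord j = i} by exists (Ordinal gi).
rewrite /degree_ge -ji in di *; set d := degn g j.
have d1 : 1 <= d%:R :> R by rewrite ler1n.
have m1 : 1 <= u.+1%:R :> R by rewrite ler1n.
have xE := pi_degE j gu; rewrite -/d in xE.
rewrite /step_mean.
under [X in p * X]eq_bigr do rewrite degn_add_vertex (gtn_eqF (ltn_ord j)) addn0.
rewrite (sum_pi_deg_if j (fun b : bool => decay (degn g j + b)%N)) // addn0 addn1.
under [X in (1 - p) * X]eq_bigr => v _ do under eq_bigr do rewrite degn_add_edge.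
rewrite (sum2_pi_deg_if j (fun b => decay (degn g j + b)%N)) // addn0 addn1 addn2.
rewrite -/d !decayS // xE; set c := decay d; set x := d%:R in d1 *; rewrite -[d.+1%:R]natr1 -/x.
set m := u.+1%:R in m1 *.
have c0 : 0 < c by exact: decay_gt0.
case/andP: p01 => p0 p1; clear xE ji; clearbody c x m.
have -> : (1 - x / (2 * m)) * c + x / (2 * m) * (c * (1 - (2 * x)^-1)) =
   c * (1 - (4 * m)^-1) by field; do ?[apply/andP; split]; lra.
have -> : (1 - x / (2 * m)) ^+ 2 * c +
   2 * (x / (2 * m)) * (1 - x / (2 * m)) * (c * (1 - (2 * x)^-1)) +
   (x / (2 * m)) ^+ 2 * (c * (1 - (2 * x)^-1) * (1 - (2 * (x + 1))^-1)) =
   c * (1 - (2 * m)^-1 + 3 / (16 * m ^+ 2) * (x / (x + 1))) by field; do ?[apply/andP; split]; lra.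
rewrite (mulrCA p) (mulrCA (1 - p)) -mulrDr ler_pM2l //.
have xx : x / (x + 1) <= 1 by rewrite ler_pdivrMr; lra.
have m4 : 0 <= (4 * m)^-1 by rewrite invr_ge0; lra.
have m16 : 0 <= 3 / (16 * m ^+ 2) by rewrite divr_ge0 // mulr_ge0 // sqr_ge0.
have {}xx := ler_wpM2l m16 xx.
rewrite mulr1 in xx; have := mulr_ge0 p0 m4.
have : 0 <= (1 - p) * (3 / (16 * m ^+ 2) - 3 / (16 * m ^+ 2) * (x / (x + 1))).
  by rewrite mulr_ge0 ?subr_ge0.
set A := 3 / _ * (x / _); set B := 3 / _; set C := (4 * m)^-1; set D := (2 * m)^-1.
by move=> ? ?; nra.
Qed.

(** An edge-step draws the ordered pair (i, j) with probability at least (y / (2 t))^2, and a step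
    is an edge-step with probability at least 1 / 2: hence the constant 8. *)
Lemma step_mean_not_joined (p y : R) (t u : nat) (g : mgraph) (i j : nat) :
  0 <= p <= 1 / 2 -> (u < t)%N -> 0 <= y -> y <= (degn g i)%:R -> y <= (degn g j)%:R ->
  size_at u g -> at_least i.+1 u g -> at_least j.+1 u g ->
  step_mean p (fun h => (~~ joined h i j)%:R) g <=
  (1 - y ^+ 2 / (8 * t%:R ^+ 2)) * (~~ joined g i j)%:R.
Proof.
move=> p01 ut y0 yi yj gu gi gj; have g0 := size_at_neq0 gu.
have p01' : 0 <= p <= 1 by lra.
have [|gij] := boolP (joined g i j).
  move=> gij; rewrite mulr0 -(step_mean_cst p 0 g0).
  apply: le_step_mean => // [v|v w]; first by rewrite joined_add_vertex.
  by rewrite joined_add_edge gij orbT.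
rewrite mulr1.
have [a ai] : {a : 'I_(nb_vertices g) | nat_of_ord a = i} by exists (Ordinal gi).
have [b bj] : {b : 'I_(nb_vertices g) | nat_of_ord b = j} by exists (Ordinal gj).
rewrite -ai -bj in yi yj gij *; clear ai bj.
have xa := pi_degE a gu; have xb := pi_degE b gu.
apply: (@le_trans _ _ (1 - (1 - p) * (@pi_deg R g a * @pi_deg R g b))).
  have -> : 1 - (1 - p) * (@pi_deg R g a * @pi_deg R g b) =
      p * 1 + (1 - p) * (1 - @pi_deg R g a * @pi_deg R g b) by ring.
  apply: lerD; apply: ler_wpM2l; rewrite ?subr_ge0; try lra.
    rewrite -[leRHS](@sum_pi_deg R g) //; apply: ler_sum => v _.
    by rewrite -[leRHS]mulr1 ler_wpM2l ?pi_deg_ge0 // lern1 leq_b1.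
  have -> : 1 - @pi_deg R g a * @pi_deg R g b =
      \sum_(u < nb_vertices g) \sum_(v < nb_vertices g) @pi_deg R g u * @pi_deg R g v *
        (1 - (u == a :> nat)%:R * (v == b :> nat)%:R).
    under eq_bigr => v _.
      under eq_bigr do rewrite -mulrA.
      rewrite -mulr_sumr (sum_pi_deg_if b (fun z : bool => 1 - (v == a :> nat)%:R * z%:R)) //.
      over.
    rewrite (sum_pi_deg_if a (fun z : bool => (1 - pi_deg b) * (1 - z%:R * 0) +
      pi_deg b * (1 - z%:R * 1))) //=.
    by ring.
  apply: ler_sum => v _; apply: ler_sum => w _.
  apply: ler_wpM2l; first by rewrite mulr_ge0 ?pi_deg_ge0.
  rewrite joined_add_edge (negbTE gij) orbF.
  by case: eqP; case: eqP => //= *; lra.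
have t0 : 0 < t%:R :> R by rewrite ltr0n; lia.
have tu : u.+1%:R <= t%:R :> R by rewrite ler_nat.
have u0 : 0 < u.+1%:R :> R by rewrite ltr0n.
have lo (c : 'I_(nb_vertices g)) : y <= (degn g c)%:R ->
    pi_deg c = (degn g c)%:R / (2 * u.+1%:R) :> R -> y / (2 * t%:R) <= @pi_deg R g c.
  move=> yc ->; apply: ler_pM => //.
  by rewrite lef_pV2 ?posrE; lra.
have := ler_pM _ _ (lo a yi xa) (lo b yj xb).
have yt : 0 <= y / (2 * t%:R) by rewrite divr_ge0 //; lra.
move=> /(_ yt yt).
have -> : y ^+ 2 / (8 * t%:R ^+ 2) = (y / (2 * t%:R) * (y / (2 * t%:R))) / 2.
  by field; do ?[apply/andP; split]; lra.
have yt2 := mulr_ge0 yt yt.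
by set A := _ * _ in yt2 *; set B := _ * _; nra.
Qed.

Variable f : R -> R.
Hypothesis f01 : forall x : R, 0 < x -> 0 <= f x <= 1.

(** Degrees never decrease, so the lower bound [y] persists as an invariant, and each of the [n]
    steps brings a factor 1 - q <= exp (- q). *)
Lemma run_mean_not_joined (y : R) (n s : nat) (g : mgraph) (i j : nat) :
  (forall u, (s <= u)%N -> f u.+1%:R <= 1 / 2) ->
  0 <= y -> y <= (degn g i)%:R -> y <= (degn g j)%:R ->
  size_at s g -> at_least i.+1 s g -> at_least j.+1 s g ->
  run_mean f n s (fun h => (~~ joined h i j)%:R) g <=
  expR (- (y ^+ 2 / (8 * (s + n)%:R ^+ 2) * n%:R)).
Proof.
move=> fs y0 yi yj gs gi gj; set q := y ^+ 2 / _.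
pose h u (k : mgraph) : R := expR (- (q * (s + n - u)%:R)) * (~~ joined k i j)%:R.
have hE : h (s + n)%N = fun k => (~~ joined k i j)%:R.
  by apply/funext => k; rewrite /h subnn mulr0 oppr0 expR0 mul1r.
have h0 : h s g <= expR (- (q * n%:R)).
  by rewrite /h addKn ler_piMr ?expR_ge0 // lern1 leq_b1.
apply: le_trans h0; rewrite -hE.
pose I u k := (size_at u k /\ at_least i.+1 u k) /\ (at_least j.+1 u k /\
  (degree_ge i (degn g i) u k /\ degree_ge j (degn g j) u k)).
apply: (@run_mean_supermartingale _ _ f01 I).
- apply: stableI; first exact: stableI size_at_stable (@at_least_stable i.+1).
  apply: stableI; first exact: at_least_stable.
  exact: stableI (@degree_ge_stable _ _) (@degree_ge_stable _ _).
- move=> u k /andP[su un] [[ku ki] [kj [kdi kdj]]].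
  have fu : 0 <= f u.+1%:R <= 1 / 2.
    by rewrite fs // andbT; case/andP: (f01 (ltr0Sn R u)).
  rewrite /h -[X in step_mean _ X _]/(fun k' => expR (- (q * (s + n - u.+1)%:R)) *
    (~~ joined k' i j)%:R).
  have -> : step_mean (f u.+1%:R) (fun k' => expR (- (q * (s + n - u.+1)%:R)) *
      (~~ joined k' i j)%:R) k = expR (- (q * (s + n - u.+1)%:R)) *
    step_mean (f u.+1%:R) (fun k' => (~~ joined k' i j)%:R) k.
    exact: (run_meanZ f 1 u).
  have := step_mean_not_joined fu un y0 _ _ ku ki kj.
  move=> /(_ (le_trans yi _) (le_trans yj _)); rewrite !ler_nat -/q => /(_ kdi kdj) kk.
  apply: le_trans (ler_wpM2l (expR_ge0 _) kk) _.
  rewrite mulrA; apply: ler_wpM2r => //.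
  have -> : (s + n - u)%N = (s + n - u.+1).+1 by lia.
  set k' := (s + n - u.+1)%N; rewrite -[k'.+1%:R]natr1 [q * (_ + 1)]mulrDr mulr1 opprD expRD.
  by apply: ler_wpM2l; rewrite ?expR_ge0 // expR_ge1Dx.
- by do 4?split; rewrite /degree_ge.
Qed.

End degree_growth.

(** * Hubs and the clique they form *)

Section many_hubs.
Context {R : realType} (f : R -> R).
Hypothesis f01 : forall x : R, 0 < x -> 0 <= f x <= 1.

(** Combines 1 - a / m <= exp (- a / m) with (1 + 1 / m)^a <= exp (a / m). It turns successive
    contractions by 1 - a / m into a power of time. *)
Lemma powR_growth (a m : R) : 0 <= a -> 1 <= m -> (1 - a / m) * ((m + 1) / m) `^ a <= 1.
Proof.
move=> a0 m1; have m0 : 0 < m by lra.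
rewrite /powR gt_eqF; last by rewrite divr_gt0 //; lra.
have -> : (m + 1) / m = 1 + m^-1 by field; lra.
have am : a * ln (1 + m^-1) <= a / m.
  by rewrite ler_wpM2l // le_ln1Dx // (@lt_le_trans _ _ 0) ?ltrN10 // invr_ge0 ltW.
apply: (@le_trans _ _ (expR (- (a / m)) * expR (a / m))).
  apply: (@le_trans _ _ (expR (- (a / m)) * expR (a * ln (1 + m^-1)))).
    by apply: ler_wpM2r; rewrite ?expR_ge0 // expR_ge1Dx.
  by apply: ler_wpM2l; rewrite ?expR_ge0 // ler_expR.
by rewrite -expRD addNr expR0.
Qed.

(** With a = (1 - eps) / 2, the product of (u + 1)^a and [decay], normalised at the final time, is a
    supermartingale. *)
Lemma run_mean_decay (eps : R) (n s : nat) (g : mgraph) (i : nat) :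
  0 < eps < 1 -> (forall u, (s <= u)%N -> f u.+1%:R <= eps / 2) ->
  3 <= 4 * eps * s.+1%:R ->
  size_at s g -> at_least i.+1 s g -> degree_ge i 1 s g ->
  run_mean f n s (fun h => decay (degn h i)) g <=
  (s.+1%:R / (s + n).+1%:R) `^ ((1 - eps) / 2).
Proof.
move=> eps01 fs seps gs gi di; set a := (1 - eps) / 2.
pose h u (k : mgraph) : R := (u.+1%:R / (s + n).+1%:R) `^ a * decay (degn k i).
have M0 : 0 < (s + n).+1%:R :> R by rewrite ltr0n.
have hE : h (s + n)%N = fun k => decay (degn k i).
  by apply/funext => k; rewrite /h divff ?lt0r_neq0 // powR1 mul1r.
have h0 : h s g <= (s.+1%:R / (s + n).+1%:R) `^ a.
  by rewrite /h ler_piMr ?powR_ge0 ?decay_le1.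
apply: le_trans h0; rewrite -hE.
pose I u k := size_at u k /\ (at_least i.+1 u k /\ degree_ge i 1 u k).
apply: (@run_mean_supermartingale _ _ f01 I).
- apply: stableI size_at_stable _.
  exact: stableI (@at_least_stable _) (@degree_ge_stable _ _).
- move=> u k /andP[su un] [ku [ki kdi]].
  have fu : 0 <= f u.+1%:R <= 1 by rewrite f01.
  have fu2 := fs u su.
  have -> : step_mean (f u.+1%:R) (h u.+1) k = (u.+2%:R / (s + n).+1%:R) `^ a *
    step_mean (f u.+1%:R) (fun k' => decay (degn k' i)) k.
    exact: (run_meanZ f 1 u).
  apply: le_trans (ler_wpM2l (powR_ge0 _ _) (step_mean_decay fu ku ki kdi)) _.
  rewrite /h mulrCA [leRHS]mulrC; apply: ler_wpM2l; first exact/ltW/decay_gt0.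
  have su' : s.+1%:R <= u.+1%:R :> R by rewrite ler_nat ltnS.
  rewrite -[u.+2%:R]natr1; set m := u.+1%:R in su' fu fu2 *; set M := (s + n).+1%:R in M0 *.
  have m1 : 1 <= m by rewrite ler1n.
  have m0 : 0 < m by lra.
  have -> : (m + 1) / M = m / M * ((m + 1) / m).
    by field; rewrite !lt0r_neq0.
  rewrite powRM; [|by apply: divr_ge0; lra|by apply: divr_ge0; lra].
  rewrite -mulrA -[leRHS]mulr1; apply: ler_wpM2l; first exact: powR_ge0.
  have a0 : 0 <= a by rewrite /a; lra.
  apply: le_trans (powR_growth a0 m1); rewrite mulrC.
  apply: ler_wpM2r; first exact: powR_ge0.
  rewrite lerD2l lerN2 /a -subr_ge0.
  have -> : (1 - f m) * ((2 * m)^-1 - 3 / (16 * m ^+ 2)) - (1 - eps) / 2 / m =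
    ((1 - f m) * (8 * m - 3) - 8 * m * (1 - eps)) / (16 * m ^+ 2).
    by field; rewrite lt0r_neq0.
  rewrite divr_ge0 ?mulr_ge0 ?sqr_ge0 //.
  have e0 : 0 < eps by lra.
  (* The slack [eps] is spent in two halves: one on f <= eps / 2, the other on the second-order term
     3 / (16 m^2). *)
  have : 3 <= 4 * eps * m by apply: le_trans seps _; rewrite ler_wpM2l //; lra.
  by nra.
- by [].
Qed.

Lemma clique_number_ge (h : mgraph) (k : nat) (S : {set 'I_k}) :
  (k <= nb_vertices h)%N ->
  (forall i j, i \in S -> j \in S -> i != j -> joined h i j) -> (#|S| <= clique_number h)%N.
Proof.
move=> kh joinS; pose w := widen_ord kh.
have -> : #|S| = #|w @: S|.
  by rewrite card_imset // => i j /(congr1 val) /= ij; exact: val_inj.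
apply: (@leq_bigmax_cond _ _ (fun A : {set 'I_(nb_vertices h)} => #|A|)).
apply/forallP => u; apply/implyP => /imsetP[i iS ->].
apply/forallP => v; apply/implyP => /imsetP[j jS ->].
by apply/implyP => wij; apply: joined_adjacent; apply: joinS => //; apply: contraNneq wij => ->.
Qed.

(** The factor 2 leaves room for half of the first [k] vertices to have too low a degree. *)
Definition small_clique (k : nat) (h : mgraph) : bool := (2 * clique_number h < k)%N.

(** If at least half of the first [k] vertices have degree at least [y], a union bound over pairs
    gives the second term; otherwise the first sum already reaches 1. This pointwise form of
    Markov's inequality is linear in [decay], so that its mean can be taken afterwards. *)
Lemma run_mean_small_clique_hubs (y : R) (k n s : nat) (g : mgraph) :
  (0 < k)%N -> (forall u, (s <= u)%N -> f u.+1%:R <= 1 / 2) -> 0 <= y ->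
  size_at s g -> at_least k s g -> no_isolated s g ->
  run_mean f n s (fun h => (small_clique k h)%:R) g <=
  \sum_(i < k) (4 * Num.sqrt y / k%:R) * decay (degn g i) +
  k%:R ^+ 2 * expR (- (y ^+ 2 / (8 * (s + n)%:R ^+ 2) * n%:R)).
Proof.
move=> k0 fs y0 gs gk gpos; have kR0 : 0 < k%:R :> R by rewrite ltr0n.
pose S := [set i : 'I_k | y <= (degn g i)%:R]%SET.
set e := expR _; have e0 : 0 <= e by exact: expR_ge0.
have term0 i : 0 <= (4 * Num.sqrt y / k%:R) * decay (degn g i).
  by rewrite !mulr_ge0 ?invr_ge0 ?sqrtr_ge0 ?ler0n // ltW // decay_gt0.
have [bigS|smallS] := leqP k (2 * #|S|).
- rewrite -[leLHS]add0r; apply: lerD; first exact: sumr_ge0.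
  (* The pairs with [i = j] stay in the sum: [run_mean_not_joined] bounds the absence of a loop
     equally well. *)
  apply: (@le_trans _ _ (run_mean f n s (fun h => \sum_(i in S) \sum_(j in S)
    (~~ joined h i j)%:R) g)).
    apply: (le_run_mean f01 (I := at_least k)) => //; first exact: at_least_stable.
    move=> h hk; have [/forall_inP joinS|/forall_inPn[i iS /forall_inPn[j jS hij]]] :=
      boolP [forall i in S, forall j in S, joined h i j].
      rewrite (_ : small_clique k h = false); first by apply: sumr_ge0 => i _; exact: sumr_ge0.
      apply/negbTE; rewrite -leqNgt (leq_trans bigS) // leq_mul2l /=.
      by apply: clique_number_ge => // i j iS jS _; exact: (forall_inP (joinS i iS)).
    rewrite (bigD1 i) //= (bigD1 j) //= hij -addrA.
    apply: (@le_trans _ _ 1); first by rewrite lern1 leq_b1.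
    by rewrite lerDl addr_ge0 // sumr_ge0 // => a _; exact: sumr_ge0.
  rewrite run_mean_sum.
  apply: (@le_trans _ _ (\sum_(i in S) \sum_(j in S) e)).
    apply: ler_sum => i; rewrite inE => yi; rewrite run_mean_sum.
    apply: ler_sum => j; rewrite inE => yj.
    by apply: run_mean_not_joined => //; apply: leq_trans gk.
  rewrite !sumr_const -mulrnA -[leLHS]mulr_natl -natrX.
  apply: ler_wpM2r => //; rewrite ler_nat.
  by rewrite -mulnn leq_mul // -[leqRHS](card_ord k) max_card.
- apply: (@le_trans _ _ 1).
    rewrite -[leRHS](run_mean_cst f01 n 1 gs); apply: (le_run_mean f01 size_at_stable) => // h _.
    by rewrite lern1 leq_b1.
  rewrite -[leLHS]addr0; apply: lerD; last by rewrite mulr_ge0 // sqr_ge0.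
  (* More than half of the indices lie outside [S], and each contributes at least 2 / k, because 2
     sqrt(y) decay(d) >= 1 for 0 < d < y. *)
  apply: (@le_trans _ _ (\sum_(i in (~: S)%SET) 2 / k%:R)).
    have := cardsC S; rewrite card_ord => Sk; rewrite sumr_const -[leRHS]mulr_natr.
    rewrite mulrAC ler_pdivlMr // mul1r -natrM ler_nat; lia.
  rewrite [leRHS](bigID (mem (~: S)%SET)) /= -[leLHS]addr0; apply: lerD; last exact: sumr_ge0.
  apply: ler_sum => i; rewrite !inE -ltNge => iy.
  have di : (0 < degn g i)%N by apply: gpos; apply: leq_trans gk.
  have sd : 0 < Num.sqrt (degn g i)%:R :> R by rewrite sqrtr_gt0 ltr0n.
  have : 1 <= 2 * Num.sqrt y * decay (degn g i).
    apply: (@le_trans _ _ (2 * Num.sqrt (degn g i)%:R * decay (degn g i))).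
      have := decay_ge (R := R) di.
      by rewrite -[_^-1]mul1r ler_pdivrMr ?mulr_gt0 // mulrC.
    by rewrite ler_pM2r ?decay_gt0 // ler_pM2l // ler_wsqrtr // ltW.
  have ki : 0 < k%:R^-1 :> R by rewrite invr_gt0.
  move=> hd; have := ler_wpM2l (ltW ki) hd; lra.
Qed.

(** The Markov property splits time at [r] and [m]: the [k] vertices are born before [r], gain
    degree until [m], and are joined between [m] and [t]. The three terms are the errors of these
    periods, in this order. *)
Lemma run_mean_small_clique (eps y : R) (k r m t : nat) :
  0 < eps < 1 -> (forall u, (r <= u)%N -> f u.+1%:R <= eps / 2) ->
  3 <= 4 * eps * r.+1%:R -> (r <= m <= t)%N -> (0 < k)%N -> 0 <= y ->
  0 < vertex_mean f r -> k%:R <= vertex_mean f r / 2 ->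
  run_mean f t 0 (fun h => (small_clique k h)%:R) single_loop <=
  4 / vertex_mean f r +
  (4 * Num.sqrt y * (r.+1%:R / m.+1%:R) `^ ((1 - eps) / 2) +
   k%:R ^+ 2 * expR (- (y ^+ 2 / (8 * t%:R ^+ 2) * (t - m)%:R))).
Proof.
move=> eps01 fr reps /andP[rm mt] k0 y0 F0 kF; set e := k%:R ^+ 2 * _.
set q := 4 * Num.sqrt y * _.
have kR0 : 0 < k%:R :> R by rewrite ltr0n.
have q0 : 0 <= q by rewrite !mulr_ge0 ?sqrtr_ge0 ?powR_ge0.
have e0 : 0 <= e by rewrite mulr_ge0 ?sqr_ge0 ?expR_ge0.
have f2 u : (r <= u)%N -> f u.+1%:R <= 1 / 2.
  by move=> /fr fu; apply: le_trans fu _; lra.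
have late g : size_at r g -> no_isolated r g -> at_least k r g ->
    run_mean f (t - r) r (fun h => (small_clique k h)%:R) g <= q + e.
  move=> gr gpos gk; have -> : (t - r = (m - r) + (t - m))%N by lia.
  rewrite run_mean_add subnKC //.
  pose I u h := size_at u h /\ (no_isolated u h /\ at_least k u h).
  have sI : stable I.
    apply: stableI size_at_stable _; apply: stableI no_isolated_stable _.
    exact: at_least_stable.
  apply: (@le_trans _ _ (run_mean f (m - r) r (fun h =>
    \sum_(i < k) (4 * Num.sqrt y / k%:R) * decay (degn h i) + e) g)).
    apply: (le_run_mean f01 sI) => // h; rewrite subnKC // => -[hm [hpos hk]].
    rewrite /e -{2}(subnKC mt); apply: run_mean_small_clique_hubs => // u mu.
    by apply: f2; apply: leq_trans mu.
  rewrite run_meanD run_mean_cst // lerD2r run_mean_sum.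
  apply: (@le_trans _ _ (\sum_(i < k) q / k%:R)); last first.
    by rewrite sumr_const card_ord -[leLHS]mulr_natr divfK // lt0r_neq0.
  apply: ler_sum => i _; rewrite run_meanZ /q mulrAC.
  rewrite ler_pM2r ?invr_gt0 //; apply: ler_wpM2l; first by rewrite mulr_ge0 ?sqrtr_ge0.
  rewrite -{2}(subnKC rm); apply: run_mean_decay => //; first exact: leq_trans gk.
  by apply: gpos; apply: leq_trans gk.
have -> : t = (r + (t - r))%N by lia.
rewrite run_mean_add add0n.
(* Too few vertices at time [r] counts as certain failure; otherwise [late] applies. *)
apply: (@le_trans _ _ (run_mean f r 0 (fun h => (nb_vertices h < k)%N%:R + (q + e)) single_loop)).
  pose I u h := size_at u h /\ no_isolated u h.
  have sI : stable I by exact: stableI size_at_stable no_isolated_stable.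
  apply: (le_run_mean f01 sI).
    move=> h; rewrite add0n => -[hr hpos]; case: ltnP => [_|hk] /=; last by rewrite add0r late.
    apply: (@le_trans _ _ 1); last by rewrite lerDl addr_ge0.
    rewrite -[leRHS](run_mean_cst f01 (t - r) 1 hr); apply: (le_run_mean f01 size_at_stable) => // h' _.
    by rewrite lern1 leq_b1.
  split; first exact: size_at_single_loop.
  by move=> [|i] //= _; rewrite /degn /= big_seq1.
rewrite run_meanD (run_mean_cst f01 r (q + e) size_at_single_loop) lerD2r.
exact: run_mean_few_vertices.
Qed.

End many_hubs.

(** * Asymptotics *)

Section asymptotics.
Context {R : realType}.

Lemma near_powR_ge (kappa C : R) : 0 < kappa -> \forall t \near \oo, C <= t%:R `^ kappa.
Proof.
move=> k0; pose D := Num.max C 1.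
have D0 : 0 < D by rewrite lt_max ltr01 orbT.
exists (Num.truncn (D `^ kappa^-1)).+1 => // t /= tD.
apply: (@le_trans _ _ D); first by rewrite le_max lexx.
have -> : D = (D `^ kappa^-1) `^ kappa.
  by rewrite -powRrM mulVf ?gt_eqF // powRr1 // ltW.
apply: ge0_ler_powR; rewrite ?nnegrE ?powR_ge0 ?ler0n //; first exact: ltW.
apply: le_trans (ltW (truncnS_gt _)) _; by rewrite ler_nat.
Qed.

(** From ln (1 + y) <= y at y = x^kappa - 1. *)
Lemma ln_le_powR (kappa x : R) : 0 < kappa -> 0 < x -> ln x <= kappa^-1 * x `^ kappa.
Proof.
move=> k0 x0; rewrite ler_pdivlMl // -ln_powR.
have := le_ln1Dx (x := x `^ kappa - 1).
rewrite addrCA subrr addr0; have := powR_gt0 kappa x0; move=> p0 /(_ _); lra.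
Qed.

(** Serves to place the time t^((1 - delta) / 2) before t / 2. *)
Lemma powR_sqrt_window (delta x : R) : 0 < delta < 1 -> 1 <= x -> 3 <= x `^ (1 / 2) ->
  1 <= x `^ ((1 - delta) / 2) /\ 3 * x `^ ((1 - delta) / 2) <= x.
Proof.
move=> d01 x1 x3; split; first by rewrite -[leLHS](powRr0 x) ler_powR //; lra.
have x0 : 0 < x by lra.
have xx : x = x `^ (1 / 2) * x `^ (1 / 2).
  rewrite -powRD; last by rewrite (gt_eqF x0) implybT.
  by rewrite (_ : 1 / 2 + 1 / 2 = 1) ?powRr1; lra.
rewrite [leRHS]xx; apply: ler_pM => //; first exact: powR_ge0.
by apply: ler_powR => //; lra.
Qed.

(** The exponent 1/4 + delta/16 - (1 + delta) (1 - delta/4) / 4 equals - delta (2 - delta) / 16,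
    which is below - delta/16. With z = x^(delta/32) this leaves z^-2: one factor beats the
    logarithm, the other the constant 1024 / delta. *)
Lemma low_degree_bound (delta x rho : R) : 0 < delta < 1 -> 1 < x ->
  1024 / delta <= x `^ (delta / 32) ->
  0 <= rho -> rho <= 4 * x `^ (- ((1 + delta) / 2)) ->
  4 * x `^ (1 / 4 + delta / 16) * rho `^ ((1 - delta / 4) / 2) <= 1 / (2 * ln x).
Proof.
move=> d01 x1 x32 rho0 rho_le; have x0 : 0 < x by lra.
have L0 : 0 < ln x by exact: ln_gt0.
have powD (b c : R) : x `^ (b + c) = x `^ b * x `^ c.
  by rewrite powRD // (gt_eqF x0) implybT.
set a := (1 - delta / 4) / 2.
have {}rho_le : rho `^ a <= 4 * x `^ (- ((1 + delta) / 2) * a).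
  apply: (@le_trans _ _ ((4 * x `^ (- ((1 + delta) / 2))) `^ a)).
    apply: ge0_ler_powR; rewrite ?nnegrE ?mulr_ge0 ?powR_ge0 // /a; lra.
  rewrite powRM ?powR_ge0 // -powRrM; apply: ler_wpM2r; first exact: powR_ge0.
  by rewrite -[leRHS]powRr1 // ler_powR // /a; lra.
have L32 : ln x <= 32 / delta * x `^ (delta / 32).
  have := @ln_le_powR (delta / 32) x; rewrite invf_div; apply => //; lra.
have exps : x `^ (1 / 4 + delta / 16) * x `^ (- ((1 + delta) / 2) * a) <=
    x `^ (- (delta / 32)) * x `^ (- (delta / 32)).
  rewrite -!powD; apply: ler_powR; first exact: ltW.
  by rewrite /a; nra.
rewrite ler_pdivlMr ?mulr_gt0 //.
rewrite powRN in exps; have := powR_gt0 (delta / 32) x0.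
have := powR_ge0 x (1 / 4 + delta / 16); have := powR_ge0 rho a.
move: exps rho_le L32 x32; set z := x `^ (delta / 32).
set p := x `^ (1 / 4 + _); set p' := x `^ (_ * a); set p'' := rho `^ a.
move: z p p' p'' (ln x) L0 {powD} => z p p' p'' L L0 exps rho_le L32 x32 p''0 p0 z0.
apply: (@le_trans _ _ (16 * (z^-1 * z^-1) * (2 * (32 / delta * z)))).
  apply: ler_pM; rewrite ?mulr_ge0 ?(ltW L0) //; last by rewrite ler_pM2l.
  apply: (@le_trans _ _ (4 * p * (4 * p'))).
    by apply: ler_wpM2l => //; rewrite mulr_ge0.
  by move: exps; set w := z^-1 * z^-1; clear; nra.
have -> : 16 * (z^-1 * z^-1) * (2 * (32 / delta * z)) = (1024 / delta) / z.
  field; rewrite !gt_eqF //; lra.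
by rewrite ler_pdivrMr // mul1r.
Qed.

(** With z = x^(delta/8), the exponent is in absolute value at least z^2 / 16, and the size of z
    makes this at least 4 ln x; what remains is x^2 x^-4 <= 1 / (2 ln x). *)
Lemma missing_edge_bound (delta x n q : R) : 0 < delta < 1 -> 2 <= x ->
  512 / delta <= x `^ (delta / 8) -> 0 <= n -> n <= x -> x / 2 <= q ->
  n ^+ 2 * expR (- (((x `^ (1 / 4 + delta / 16)) ^+ 2) ^+ 2 / (8 * x ^+ 2) * q)) <=
  1 / (2 * ln x).
Proof.
move=> d01 x2 x8 n0 nx xq; have x0 : 0 < x by lra.
have L0 : 0 < ln x by apply: ln_gt0; lra.
have powD (b c : R) : x `^ (b + c) = x `^ b * x `^ c.
  by rewrite powRD // (gt_eqF x0) implybT.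
have L8 : ln x <= 8 / delta * x `^ (delta / 8).
  have := @ln_le_powR (delta / 8) x; rewrite invf_div; apply => //; lra.
have y2 : ((x `^ (1 / 4 + delta / 16)) ^+ 2) ^+ 2 = x * (x `^ (delta / 8)) ^+ 2.
  rewrite -!exprM /= -powR_mulrn ?powR_ge0 // -powRrM.
  rewrite -[(x `^ (delta / 8)) ^+ 2]powR_mulrn ?powR_ge0 // -powRrM.
  rewrite -[X in _ = X * _]powRr1 ?(ltW x0) // -powD; congr powR; lra.
have Lx : ln x <= x.
  by have := le_ln1Dx (x := x - 1); rewrite addrCA subrr addr0 => /(_ _); lra.
have x4 : expR (- (4 * ln x)) = (x ^+ 4)^-1.
  by rewrite expRN (mulrC 4) expRM_natr lnK ?posrE.
rewrite y2; have := powR_gt0 (delta / 8) x0.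
move: L8 x8; set z := x `^ (delta / 8).
move: z (ln x) L0 Lx x4 {powD y2} => z L L0 Lx x4 L8 x8 z0.
have big : 4 * L <= x * z ^+ 2 / (8 * x ^+ 2) * q.
  apply: (@le_trans _ _ (x * z ^+ 2 / (8 * x ^+ 2) * (x / 2))); last first.
    by apply: ler_wpM2l => //; rewrite divr_ge0 ?mulr_ge0 ?sqr_ge0 // ltW.
  have -> : x * z ^+ 2 / (8 * x ^+ 2) * (x / 2) = z * z / 16.
    by field; rewrite gt_eqF.
  have := ler_wpM2r (ltW z0) x8.
  have -> : 512 / delta * z = 64 * (8 / delta * z) by ring.
  by move: (8 / delta * z) (z * z) L8; clear => u v ? ?; lra.
apply: (@le_trans _ _ (x ^+ 2 * expR (- (4 * L)))).
  apply: ler_pM; rewrite ?sqr_ge0 ?expR_ge0 //.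
    by rewrite lerXn2r ?nnegrE ?(ltW x0).
  by rewrite ler_expR lerN2.
rewrite x4 ler_pdivlMr ?mulr_gt0 //.
have -> : x ^+ 2 * (x ^+ 4)^-1 * (2 * L) = 2 * L / x ^+ 2 by field; rewrite gt_eqF.
by rewrite ler_pdivrMr ?exprn_gt0 // mul1r; move: Lx x2 x0; clear; nra.
Qed.

Lemma hub_bounds (delta : R) (t : nat) (r := Num.truncn (t%:R `^ ((1 - delta) / 2) : R)) :
  0 < delta < 1 -> expR 1 <= t%:R :> R -> 3 <= t%:R `^ (1 / 2) :> R ->
  1024 / delta <= t%:R `^ (delta / 32) -> 512 / delta <= t%:R `^ (delta / 8) ->
  [/\ 1 <= ln t%:R :> R, (r <= t./2 <= t)%N,
   4 * t%:R `^ (1 / 4 + delta / 16) *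
     (r.+1%:R / (t./2).+1%:R) `^ ((1 - delta / 4) / 2) <= 1 / (2 * ln t%:R) &
   r.+1%:R ^+ 2 * expR (- (((t%:R `^ (1 / 4 + delta / 16)) ^+ 2) ^+ 2 /
     (8 * t%:R ^+ 2) * (t - t./2)%:R)) <= 1 / (2 * ln t%:R)].
Proof.
move=> d01 t1 t3 t32 t8.
have e2 : 2 <= expR 1 :> R by have := expR_ge1Dx (1 : R); lra.
have t2 : 2 <= t%:R :> R by exact: le_trans e2 t1.
have t0 : 0 < t%:R :> R by exact: lt_le_trans t2.
have t1' : 1 < t%:R :> R by move: t2; clear; lra.
have [A1 Ax] := powR_sqrt_window d01 (ltW t1') t3.
have rA : r%:R <= t%:R `^ ((1 - delta) / 2) :> R by rewrite truncn_le powR_ge0.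
have rS : r.+1%:R <= 2 * t%:R `^ ((1 - delta) / 2) :> R.
  by rewrite -natr1; move: rA A1; clear; lra.
have rt : (2 * r + 1 <= t)%N.
  by rewrite -(ler_nat R) natrD natrM; move: rA A1 Ax; clear; lra.
have m2 : t%:R <= 2 * (t./2).+1%:R :> R by rewrite -natrM ler_nat; clear; lia.
split.
- by rewrite -[leLHS]expRK ler_ln ?posrE ?expR_gt0.
- by move: rt; clear; lia.
(* One factor 2 of the constant 4 comes from passing from [r] to [r.+1], the other from halving
   [t]. *)
- apply: low_degree_bound => //.
  have -> : - ((1 + delta) / 2) = (1 - delta) / 2 + - 1 by lra.
  rewrite powRD; last by rewrite (gt_eqF t0) implybT.
  rewrite powR_inv1 ?ler0n // mulrA ler_pdivrMr ?ltr0n // mulrAC ler_pdivlMr //.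
  have := ler_pM (ler0n _ _) (ler0n _ _) rS m2.
  by move/le_trans; apply; rewrite le_eqVlt; apply/orP; left; apply/eqP; ring.
- apply: missing_edge_bound => //; first by rewrite ler_nat; move: rt; clear; lia.
  by rewrite ler_pdivrMr // -natrM ler_nat; clear; lia.
Qed.

Lemma near_hub_bounds (delta : R) : 0 < delta < 1 ->
  \forall t \near \oo, [/\ expR 1 <= t%:R :> R, 3 <= t%:R `^ (1 / 2) :> R,
    1024 / delta <= t%:R `^ (delta / 32) & 512 / delta <= t%:R `^ (delta / 8)].
Proof.
move=> d01; near=> t; split.
- have : expR 1 <= (t%:R : R) `^ 1 by near: t; exact: near_powR_ge.
  by rewrite powRr1.
- by near: t; apply: near_powR_ge.
- by near: t; apply: near_powR_ge; lra.
- by near: t; apply: near_powR_ge; lra.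
Unshelve. all: by end_near.
Qed.

End asymptotics.

(** * Choice of the constant and conclusion *)

Theorem theorem1 (R : realType) (f : R -> R)
  (f01 : forall x : R, 0 < x -> 0 <= f x <= 1)
  (f_decr : forall x y : R, 0 < x -> x <= y -> f y <= f x)
  (f_lim : f x @[x --> +oo] --> (0 : R))
  (delta : R) (delta01 : 0 < delta < 1) :
  exists2 c2 : R, 0 < c2 &
    forall (d : measure_display) (T : measurableType d) (P : probability T R)
           (Z : nat -> T -> bool) (G : nat -> T -> mgraph),
      is_process f P Z G ->
      forall t : nat, (2 <= t)%N ->
        let r : R := t%:R `^ ((1 - delta) / 2) in
        let L : R := ln t%:R in
        (P [set x | (c2 * mean_nb_vertices P G r / L <= (clique_number (G t x))%:R)%R] >=
         (1 - 2 / L - expR (- (c2 * mean_nb_vertices P G (r * L) / (4 * L))))%:E)%E.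
Proof.
(* With this slack the contraction exponent (1 + delta) (1 - eps) / 4 exceeds 1/4 + delta/16, the
   exponent of the square root of the hub degree. *)
pose eps := delta / 4.
have eps01 : 0 < eps < 1 by rewrite /eps; lra.
have eps0 : 0 < eps by lra.
have [M [_ fM]] : \forall x \near +oo, `|0 - f x| < eps / 2.
  by move/cvgrPdist_lt : f_lim; apply; lra.
(* From time [s0] on, [f] is at most eps / 2 and the second-order term of the contraction is
   absorbed. *)
pose s0 := maxn (Num.truncn M).+1 (Num.truncn (3 / (4 * eps))).+1.
have fs0 u : (s0 <= u)%N -> f u.+1%:R <= eps / 2.
  rewrite geq_max => /andP[uM _]; apply: ltW; apply: le_lt_trans (ler_norm _) _; rewrite -normrN -sub0r.
  apply: fM.
  by apply: lt_le_trans (truncnS_gt _) _; rewrite ler_nat; exact: leqW.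
have epss0 u : (s0 <= u)%N -> 3 <= 4 * eps * u.+1%:R.
  rewrite geq_max => /andP[_ ue]; rewrite mulrC -ler_pdivrMr; last by lra.
  by apply: le_trans (ltW (truncnS_gt _)) _; rewrite ler_nat; exact: leqW.
have [t0 _ large] : \forall t \near \oo, s0%:R <= t%:R `^ ((1 - delta) / 2) :> R /\
    [/\ expR 1 <= t%:R :> R, 3 <= t%:R `^ (1 / 2) :> R,
      1024 / delta <= t%:R `^ (delta / 32) & 512 / delta <= t%:R `^ (delta / 8)].
  near=> t; split; first by near: t; apply: near_powR_ge; lra.
  by near: t; exact: near_hub_bounds.
have ln2 : 0 < ln 2 :> R by apply: ln_gt0; rewrite ltr1n.
(* The bound 1 / 8 fits a clique of size k / 2 with k about F / 2, and makes F at least 8 log t once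
   the threshold exceeds 1. The other bound keeps the threshold at most 1 for t < t0, where F <= t0
   + 1 and log t >= ln 2. *)
pose c2 : R := Num.min (1 / 8) (ln 2 / t0.+1%:R).
have c2_gt0 : 0 < c2 by rewrite lt_min !divr_gt0.
exists c2 => // d T P Z G process t t2; cbv zeta.
set r := t%:R `^ ((1 - delta) / 2); set L := ln t%:R.
pose s := Num.truncn r; pose F := vertex_mean f s.
have L0 : 0 < L by apply: ln_gt0; rewrite ltr1n.
have threshold : c2 * mean_nb_vertices P G r / L <= c2 * F / L.
  by rewrite ler_pM2r ?invr_gt0 // ler_pM2l // (mean_nb_vertices_le f01 r process).
have le_event (bad : mgraph -> bool) :
    (forall h, (0 < nb_vertices h)%N -> ~~ bad h -> c2 * F / L <= (clique_number h)%:R) ->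
    run_mean f t 0 (fun h => (bad h)%:R) single_loop <= 2 / L ->
    (P [set x | (c2 * mean_nb_vertices P G r / L <= (clique_number (G t x))%:R)%R] >=
     (1 - 2 / L - expR (- (c2 * mean_nb_vertices P G (r * L) / (4 * L))))%:E)%E.
  move=> good bad_le.
  (* A failure probability of at most 2 / L is enough, since the exponential subtracted in the claim
     is nonnegative. *)
  apply: (@le_trans _ _ (1 - run_mean f t 0 (fun h => (bad h)%:R) single_loop)%:E).
    by rewrite lee_fin; have := expR_ge0 (- (c2 * mean_nb_vertices P G (r * L) / (4 * L))); lra.
  pose A (h : mgraph) : Prop := c2 * mean_nb_vertices P G r / L <= (clique_number h)%:R.
  rewrite [leRHS](_ : _ = (run_mean f t 0 (fun h => (`[< A h >])%:R) single_loop)%:E);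
    last exact: prob_process process f01 A t.
  rewrite lee_fin lerBlDr -run_meanD.
  rewrite -[leLHS](run_mean_cst f01 t 1 size_at_single_loop).
  apply: (le_run_mean f01 (@at_least_stable 1)) => // h h0.
  case: (boolP (bad h)) => [_|/(good h h0) hF] /=; first by rewrite lerDr.
  by rewrite (asboolT (le_trans threshold hF : A h)) addr0.
(* When the threshold is at most 1, a single vertex is a large enough clique, so the bad event is
   taken empty. *)
have [small|big] := leP (c2 * F / L) 1.
  apply: (le_event pred0) => [h h0 _|]; last by rewrite run_mean_cst // divr_ge0 // ltW.
  apply: le_trans small _; rewrite ler1n -(cards1 (ord0 : 'I_1)).
  by apply: clique_number_ge => // i j _ _; rewrite [i]ord1 [j]ord1 eqxx.
have F_large : L < c2 * F by rewrite ltr_pdivlMr ?mul1r in big.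
have c8 : c2 <= 1 / 8 by rewrite ge_min lexx.
have F0 : 0 < F by rewrite -(pmulr_rgt0 _ c2_gt0); exact: lt_trans F_large.
have F8 : 8 * L <= F by have := ler_wpM2r (ltW F0) c8; lra.
have x1 : 1 <= t%:R :> R by rewrite ler1n ltnW.
have rt : r <= t%:R by rewrite -[leRHS]powRr1 // ler_powR //; lra.
have t_large : (t0 <= t)%N.
  rewrite leqNgt; apply/negP => tt0.
  have Ft : F <= t0.+1%:R.
    apply: le_trans (vertex_mean_le f01 _) _; rewrite ler_nat ltnS.
    by rewrite -(ler_nat R) (le_trans _ (le_trans rt _)) ?truncn_le ?powR_ge0 // ler_nat ltnW.
  have lnt : ln 2 <= L by rewrite ler_ln ?posrE ?ltr0n ?ler_nat // ltnW.
  have : c2 * F <= ln 2 / t0.+1%:R * t0.+1%:R.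
    by apply: ler_pM => //; [exact: ltW|exact: ltW|rewrite ge_min lexx orbT].
  rewrite divfK ?pnatr_eq0 //; lra.
have [s0r [t1 t3 t32 t8]] := large t t_large.
have := hub_bounds delta01 t1 t3 t32 t8; rewrite -/r -/s -/L -/eps.
case=> L1 rmt bound_deg bound_edge.
have s0s : (s0 <= s)%N by rewrite truncn_ge_nat ?powR_ge0.
pose k := Num.truncn (F / 2).
have F4 : 4 <= F / 2 by move: F8 L1; clear; lra.
have kF : k%:R <= F / 2 by rewrite truncn_le divr_ge0 // ltW.
have Fk : F / 2 < k.+1%:R by exact: truncnS_gt.
have k0 : (0 < k)%N by rewrite truncn_gt0; apply: le_trans F4; rewrite ler1n.
apply: (le_event (small_clique k)) => [h h0|].
  rewrite /small_clique -leqNgt -(ler_nat R) natrM => kh.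
  rewrite ler_pdivrMr //; rewrite -[k.+1%:R]natr1 in Fk.
  apply: (@le_trans _ _ (1 / 8 * F)); first by rewrite ler_pM2r.
  apply: (@le_trans _ _ (clique_number h)%:R); first by move: kh Fk F4; clear; lra.
  by rewrite ler_peMr.
(* The hub degree t^(1/2 + delta/8), written as a square so that its root comes out at once. *)
set y := (t%:R `^ (1 / 4 + delta / 16)) ^+ 2.
have y0 : 0 <= y by exact: sqr_ge0.
have fs u : (s <= u)%N -> f u.+1%:R <= eps / 2 by move=> su; apply: fs0; exact: leq_trans su.
apply: le_trans (run_mean_small_clique f01 eps01 fs (epss0 s s0s) rmt k0 y0 F0 kF) _.
rewrite sqrtr_sqr ger0_norm ?powR_ge0 //.
have invF : 4 / F <= 1 / (2 * L).
  by rewrite ler_pdivrMr // mulrAC ler_pdivlMr ?mulr_gt0 //; move: F8; clear; lra.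
have edge : k%:R ^+ 2 * expR (- (y ^+ 2 / (8 * t%:R ^+ 2) * (t - t./2)%:R)) <= 1 / (2 * L).
  apply: le_trans bound_edge; apply: ler_wpM2r; first exact: expR_ge0.
  rewrite lerXn2r ?nnegrE // (le_trans kF) //.
  by apply: le_trans (vertex_mean_le f01 s); move: F0; rewrite -/F; clear; lra.
(* Three errors of at most 1 / (2 L) add up to 3 / (2 L), below 2 / L. *)
have half : 1 / (2 * L) = 2 / L / 4 by field; rewrite gt_eqF.
have iL : 0 < 2 / L by rewrite divr_gt0.
by move: invF bound_deg edge half iL; clear; lra.
Unshelve. all: by end_near.
Qed.
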